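(* Let $\lambda,\gamma,\mu$ be weakly decreasing triples of nonnegative rational numbers with the same total sum and with $\lambda\succ\gamma\succ\mu$. Put $P_{\lambda,\gamma,\mu}=J_\lambda+J_\mu-2J_\gamma$ and $$Q(t)=\sum_{i=1}^3 t^{\lambda_i}+\sum_{i=1}^3 t^{\mu_i}-2\sum_{i=1}^3 t^{\gamma_i}.$$ Then $P_{\lambda,\gamma,\mu}(x,y,z)\ge 0$ for all real $x,y,z>0$ if and only if $Q(t)\ge 0$ for all real $t>0$.
   Context: For a triple $\eta=(\eta_1,\eta_2,\eta_3)$ of nonnegative rationals and positive reals $x_1,x_2,x_3$, the labeled orbit sum is $J_\eta(x_1,x_2,x_3)=\sum_{\sigma\in S_3}\prod_{i=1}^3 x_i^{\eta_{\sigma(i)}}$ (all six permutations are counted, also when exponents repeat). For weakly decreasing triples $a,b$ with the same total sum, $a\succcurlyeq b$ means $a_1\ge b_1$ and $a_1+a_2\ge b_1+b_2$; $a\succ b$ means $a\succcurlyeq b$ and $a\ne b$. With these conventions $P_{\lambda,\gamma,\mu}(t,1,1)=2Q(t)$. *)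

(* Defs.v *)
From HB Require Import structures.
From mathcomp Require Import all_boot all_order all_algebra all_fingroup.
From mathcomp Require Import all_classical all_reals all_analysis.
Set Implicit Arguments.
Unset Strict Implicit.
Unset Printing Implicit Defensive.
Import Order.TTheory GRing.Theory Num.Theory.
Local Open Scope ring_scope.

Definition weakly_decreasing (a : 3.-tuple rat) : Prop := sorted >=%R a.

Definition nonneg_triple (a : 3.-tuple rat) : Prop :=
  forall i : 'I_3, 0 <= tnth a i.

Definition triple_sum (a : 3.-tuple rat) : rat := \sum_(i < 3) tnth a i.

(* Dominance order; it is only meaningful on weakly decreasing triples with
   equal sums, which is not part of the predicate. *)
Definition dominates (a b : 3.-tuple rat) : Prop :=
  b`_0 <= a`_0 /\ b`_0 + b`_1 <= a`_0 + a`_1.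

Definition strictly_dominates (a b : 3.-tuple rat) : Prop :=
  dominates a b /\ a <> b.

(* The sum is over all six permutations, also when exponents repeat. *)
Definition orbit_sum (R : realType) (eta : 3.-tuple rat) (x1 x2 x3 : R) : R :=
  \sum_(s : 'S_3)
    \prod_(i < 3) (tnth [tuple x1; x2; x3] i) `^ (ratr (tnth eta (s i))).

Definition P_fun (R : realType) (lambda gamma mu : 3.-tuple rat)
    (x y z : R) : R :=
  orbit_sum lambda x y z + orbit_sum mu x y z - 2 * orbit_sum gamma x y z.

Definition Q_fun (R : realType) (lambda gamma mu : 3.-tuple rat) (t : R) : R :=
  \sum_(i < 3) t `^ (ratr (tnth lambda i))
  + \sum_(i < 3) t `^ (ratr (tnth mu i))
  - 2 * \sum_(i < 3) t `^ (ratr (tnth gamma i)).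

(* Main.v *)
(** Centre the exponents so that each triple sums to 0, and for x >= y >= z put
    s = ln (x / y) and r = ln (y / z). With p_eta (t) = sum_i exp (t eta_i), the
    orbit sum becomes J_eta = p_eta (s) p_eta (- r) - p_eta (s - r), while Q (t)
    becomes a combination of the p_eta (ln t). By the symmetry eta -> - eta one
    may take 0 < r <= s.

    Tangent functional: there are nonnegative weights, depending on gamma, such
    that G = J - (weighted sum of p at the four wall points - r, s, s + r and
    s - (m + 1) r, with m the integral part of s / r) has gamma as a critical
    point. If G (lambda) >= G (gamma) and G (mu) >= G (gamma), then P dominates a
    nonnegative combination of values of Q. With u_i = exp (- r gamma_i), the
    weights come from interpolating u ^ m by 1, u^-1 and u^-2 at the three u_i,
    and their positivity is that of complete homogeneous polynomials. The
    interpolation error at the exponents of another triple is linear in the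
    variations of the elementary symmetric functions of the u_i, so that the
    derivative of G along a dominance segment is a sum of increasing exponentials
    tested against a vector of the dominance cone. This settles mu, and lambda
    when lambda_2 >= gamma_3; when lambda_2 < gamma_3 an extra estimate is needed
    and is valid unless lambda is so far from gamma that J_lambda alone wins. *)

Require Import Defs.
From mathcomp Require Import all_boot all_order all_algebra all_fingroup.
From mathcomp Require Import all_classical all_reals all_analysis.
From mathcomp Require Import ring lra.
Set Implicit Arguments.
Unset Strict Implicit.
Unset Printing Implicit Defensive.
Import Order.TTheory GRing.Theory Num.Theory.
Import numFieldNormedType.Exports.
Local Open Scope ring_scope.

(** * Symmetric functions of the nodes *)

Section CompleteHomogeneous.
Variables (R : realFieldType) (x1 x2 x3 : R).

(** The complete homogeneous polynomial of degree [n] in [x1] and [x2]. *)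
Fixpoint hsym2 n : R := if n is k.+1 then x2 * hsym2 k + x1 ^+ n else 1.

(* [hsym n] is the complete homogeneous polynomial of degree [n - 1], so that
   [hsym 0 = 0]. *)
Fixpoint hsym n : R := if n is k.+1 then x3 * hsym k + hsym2 k else 0.

Lemma hsym_rec n : hsym n.+3 =
  (x1 + x2 + x3) * hsym n.+2 - (x1 * x2 + x1 * x3 + x2 * x3) * hsym n.+1
  + x1 * x2 * x3 * hsym n.
Proof. rewrite /= [x1 ^+ n.+2]exprS; ring. Qed.

Hypotheses (x1_gt0 : 0 < x1) (x2_gt0 : 0 < x2) (x3_gt0 : 0 < x3).

Lemma hsym2_gt0 n : 0 < hsym2 n.
Proof.
elim: n => [|n IHn] /=; first exact: ltr01.
by rewrite addr_gt0 ?mulr_gt0 ?exprn_gt0.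
Qed.

Lemma hsym_ge0 n : 0 <= hsym n.
Proof.
elim: n => [|n IHn] //=.
by rewrite addr_ge0 ?mulr_ge0 // ltW ?hsym2_gt0.
Qed.

Lemma hsym_gt0 n : 0 < hsym n.+1.
Proof. by rewrite /= ltr_wpDl ?hsym2_gt0 // mulr_ge0 ?hsym_ge0 // ltW. Qed.

Lemma hsym_growth n : x3 * hsym n <= hsym n.+1.
Proof. by rewrite /= lerDl ltW ?hsym2_gt0. Qed.

End CompleteHomogeneous.

(** * Interpolation error under a perturbation of the nodes *)

Section Tail.
Variables (R : realFieldType) (c : nat -> R).

(** Horner form of the sum over [j < n] of [u ^ (n - j) * (d2 * c (j + 1) - d1 * c j)]. *)
Fixpoint tail (d1 d2 u : R) n : R :=
  if n is k.+1 then u * (tail d1 d2 u k + (d2 * c k.+1 - d1 * c k)) else 0.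

Lemma tailS d1 d2 u n :
  tail d1 d2 u n.+1 = u * (tail d1 d2 u n + (d2 * c n.+1 - d1 * c n)).
Proof. by []. Qed.

Lemma tailD d1 d2 d1' d2' u n :
  tail (d1 + d1') (d2 + d2') u n = tail d1 d2 u n + tail d1' d2' u n.
Proof. elim: n => [|n IHn] /=; first by rewrite addr0. by rewrite IHn; ring. Qed.

Lemma tailZ a d1 d2 u n : tail (a * d1) (a * d2) u n = a * tail d1 d2 u n.
Proof. elim: n => [|n IHn] /=; first by rewrite mulr0. by rewrite IHn; ring. Qed.

(* At a root of [X ^ 3 - f2 X ^ 2 + f1 X - 1] one has [u^-1 = f1 - f2 u + u ^ 2],
   so the left-hand side is [u ^ (n + 2)] minus its interpolant in [u^-1, 1, u]
   at the roots of [X ^ 3 - e2 X ^ 2 + e1 X - 1]. The point is that the result is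
   linear in the perturbation of the coefficients. *)
Lemma tail_root (e1 e2 f1 f2 u : R) n :
    c 0%N = 0 -> c 1%N = 1 -> c 2 = e2 ->
    (forall k, c k.+3 = e2 * c k.+2 - e1 * c k.+1 + c k) ->
    u ^+ 3 = f2 * u ^+ 2 - f1 * u + 1 ->
  u ^+ n.+2 - c n.+2 * u - c n.+1 * (f1 - f2 * u + u ^+ 2)
    + (e1 * c n.+1 - c n) =
  - (c n.+1 * (f1 - e1)) + tail (f1 - e1) (f2 - e2) u n.+1.
Proof.
move=> c0 c1 c2 crec u3; elim: n => [|n IHn]; first by rewrite /= c0 c1 c2; ring.
rewrite [tail _ _ _ _]/= -/(tail (f1 - e1) (f2 - e2) u n.+1).
have -> : tail (f1 - e1) (f2 - e2) u n.+1 =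
   u ^+ n.+2 - c n.+2 * u - c n.+1 * (f1 - f2 * u + u ^+ 2)
    + (e1 * c n.+1 - c n) + c n.+1 * (f1 - e1) by rewrite IHn; ring.
rewrite crec [u ^+ n.+3]exprS.
have -> : u * (u ^+ n.+2 - c n.+2 * u - c n.+1 * (f1 - f2 * u + u ^+ 2) +
   (e1 * c n.+1 - c n) + c n.+1 * (f1 - e1) +
   ((f2 - e2) * c n.+2 - (f1 - e1) * c n.+1)) =
  u * u ^+ n.+2 - c n.+2 * u ^+ 2 + c n.+1 * (f2 * u ^+ 2 - f1 * u - u ^+ 3)
   + u * (e1 * c n.+1 - c n + (f2 - e2) * c n.+2) by ring.
by rewrite u3; ring.
Qed.

End Tail.

(** * Exponential sums *)

(** Abel summation: the vector is [v1] times [(1, -1, 0)] plus [- v3] times [(0, 1, -1)]. *)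
Lemma cone_ge0 (R : realFieldType) (v1 v2 v3 w1 w2 w3 : R) :
    0 <= v1 -> v3 <= 0 -> v1 + v2 + v3 = 0 -> w2 <= w1 -> w3 <= w2 ->
  0 <= v1 * w1 + v2 * w2 + v3 * w3.
Proof.
move=> v1_ge0 v3_le0 sv w21 w32.
have -> : v1 * w1 + v2 * w2 + v3 * w3 = v1 * (w1 - w2) + (- v3) * (w2 - w3).
  have -> : v2 = - v1 - v3 by lra.
  by ring.
by rewrite addr_ge0 // mulr_ge0 ?subr_ge0 ?oppr_ge0.
Qed.

Lemma lerp_le (R : realFieldType) (t x y x' y' : R) :
    0 <= t <= 1 -> x <= x' -> y <= y' ->
  x + t * (y - x) <= x' + t * (y' - x').
Proof.
move=> /andP[t0 t1] xx yy.
have := mulr_ge0 t0 (ltac:(lra) : 0 <= y' - y).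
have := mulr_ge0 (ltac:(lra) : 0 <= 1 - t) (ltac:(lra) : 0 <= x' - x).
lra.
Qed.

Lemma lerp_ge (R : realFieldType) (t x y z : R) :
  0 <= t <= 1 -> z <= x -> z <= y -> z <= x + t * (y - x).
Proof.
move=> t01 zx zy; have := lerp_le t01 zx zy.
by rewrite subrr mulr0 addr0.
Qed.

Lemma lerp_le_cst (R : realFieldType) (t x y z : R) :
  0 <= t <= 1 -> x <= z -> y <= z -> x + t * (y - x) <= z.
Proof.
move=> t01 zx zy; have := lerp_le t01 zx zy.
by rewrite subrr mulr0 addr0.
Qed.

Section Exponential.
Variable R : realType.
Implicit Types (t s r x y : R).

Lemma expR_tangent x y : expR x * (y - x) <= expR y - expR x.
Proof.
have -> : expR y - expR x = expR x * (expR (y - x) - 1).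
  by rewrite mulrBr -expRD mulr1; congr (expR _ - _); ring.
by rewrite ler_wpM2l ?expR_ge0 // lerBrDl expR_ge1Dx.
Qed.

Definition psum t (a b c : R) := expR (t * a) + expR (t * b) + expR (t * c).

(** The orbit sum of [(a, b, c)] at the point [(exp s, 1, exp (- r))]. *)
Definition jsum s r (a b c : R) :=
  expR (s * a - r * b) + expR (s * a - r * c)
  + expR (s * b - r * a) + expR (s * b - r * c)
  + expR (s * c - r * a) + expR (s * c - r * b).

Lemma jsumE s r a b c :
  jsum s r a b c = psum s a b c * psum (- r) a b c - psum (s - r) a b c.
Proof. by rewrite /jsum /psum !mulrBl !mulNr !expRD; ring. Qed.

Lemma mul_expR_mono t x y : x <= y -> t * expR (t * x) <= t * expR (t * y).
Proof.
move=> xy; case: (leP 0 t) => t0.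
  by rewrite ler_wpM2l // ler_expR ler_wpM2l.
by rewrite ler_wnM2l ?ler_expR ?ler_wnM2l // ltW.
Qed.

(** Karamata's inequality: the tangents at the dominated triple have ordered slopes, which
    [cone_ge0] pairs with the displacement. *)
Lemma psum_mono t a b c a' b' c' :
    b <= a -> c <= b -> a <= a' -> c' <= c -> a + b + c = a' + b' + c' ->
  psum t a b c <= psum t a' b' c'.
Proof.
move=> ba cb aa cc sum_eq; rewrite -subr_ge0.
have Ha := expR_tangent (t * a) (t * a').
have Hb := expR_tangent (t * b) (t * b').
have Hc := expR_tangent (t * c) (t * c').
have := @cone_ge0 R (a' - a) (b' - b) (c' - c) _ _ _ _ _ _
  (mul_expR_mono t ba) (mul_expR_mono t cb).
move/(_ ltac:(lra) ltac:(lra) ltac:(lra)); rewrite /psum.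
rewrite -!mulrBr in Ha Hb Hc; lra.
Qed.

Lemma jsum_mono s r a b c a' b' c' :
    0 <= s -> 0 <= r ->
    b <= a -> c <= b -> a <= a' -> c' <= c -> a + b + c = a' + b' + c' ->
  jsum s r a b c <= jsum s r a' b' c'.
Proof.
move=> s0 r0 ba cb aa cc sum_eq; rewrite -subr_ge0.
pose T x y x' y' := expR_tangent (s * x - r * y) (s * x' - r * y').
pose F x := expR (s * x); pose H x := expR (- r * x).
have FH x y : expR (s * x - r * y) = F x * H y by rewrite -expRD mulNr.
(* [X x y z] is the partial derivative of [jsum s r] in [x], the other two exponents being [y] and
   [z]. *)
pose X x y z := s * (F x * H y + F x * H z) - r * (F y * H x + F z * H x).
have Fle x y : x <= y -> F x <= F y by move=> xy; rewrite ler_expR ler_wpM2l.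
have Hle x y : x <= y -> H y <= H x.
  by move=> xy; rewrite ler_expR ler_wnM2l // oppr_le0.
have F0 x : 0 <= F x by rewrite expR_ge0.
have H0 x : 0 <= H x by rewrite expR_ge0.
have Xle x y z : y <= x -> X y x z <= X x y z.
  move=> yx; rewrite -subr_ge0 /X.
  have -> : s * (F x * H y + F x * H z) - r * (F y * H x + F z * H x)
     - (s * (F y * H x + F y * H z) - r * (F x * H y + F z * H y)) =
     s * ((F x - F y) * H z + (F x * (H y - H x) + (F x - F y) * H x))
     + r * ((F x * (H y - H x) + (F x - F y) * H x) + F z * (H y - H x)) by ring.
  have := Fle _ _ yx; have := Hle _ _ yx; rewrite -subr_ge0 => H1.
  rewrite -subr_ge0 => F1.
  by rewrite addr_ge0 // mulr_ge0 // addr_ge0 ?mulr_ge0 // addr_ge0 ?mulr_ge0.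
have X32 : X c b a <= X b c a by exact: Xle.
have X21 : X b a c <= X a b c by exact: Xle.
have := @cone_ge0 R (a' - a) (b' - b) (c' - c) (X a b c) (X b a c) (X c a b).
move/(_ ltac:(lra) ltac:(lra) ltac:(lra) X21).
have -> : X b a c = X b c a by rewrite /X; ring.
have -> : X c a b = X c b a by rewrite /X; ring.
move/(_ X32).
have := (T a b a' b', T a c a' c', T b a b' a', T b c b' c', T c a c' a', T c b c' b').
rewrite /T => -[[[[[]]]]]; rewrite /jsum /X !FH => t1 t2 t3 t4 t5 t6 cone.
lra.
Qed.

End Exponential.

(** In [gap_far], [T], [a] and [b] are such that the right-hand side is the growth of [psum s] from
    the corner [(- 2 g3, g3, g3)]. *)
Lemma far_increment_bound (R : realFieldType) (T p a b : R) :
    1 <= a -> 1 <= b -> 1 <= p -> p ^+ 2 = a * b -> p <= T -> p <= 7 / 4 ->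
  T ^+ 2 * (a * b) * ((a - 1) * (b - 1)) <=
  T ^+ 2 * (a * b - 1) + T^-1 * (a^-1 + b^-1 - 2).
Proof.
move=> a1 b1 p1 pE pT p74.
have [a0 b0 p0 T0] : [/\ 0 < a, 0 < b, 0 < p & 0 < T] by split; lra.
(* The difference of the two sides increases with [a + b], so [a = b] is the
   worst case. *)
have q_ge : 2 * p <= a + b.
  rewrite -(@ler_pXn2r _ 2) ?nnegrE //; try lra.
  have := sqr_ge0 (a - b); rewrite exprMn pE; lra.
have -> : a^-1 + b^-1 = (a + b) / p ^+ 2.
  by rewrite pE; field; rewrite !lt0r_neq0.
have -> : (a - 1) * (b - 1) = p ^+ 2 - (a + b) + 1 by rewrite pE; ring.
rewrite -pE; move: (a + b) q_ge => q q_ge.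
have poly_ge : 0 <= 2 + 2 * p + 2 * p ^+ 2 + 2 * p ^+ 3 + p ^+ 4 - p ^+ 6.
  have w_ge : 0 <= 49 / 16 - p ^+ 2 by nra.
  have w1 : 0 <= p ^+ 2 - 1 by nra.
  have H1 : p ^+ 4 * (p ^+ 2 - 1) <= p ^+ 2 * (49 / 16) * (33 / 16).
    have -> : p ^+ 4 * (p ^+ 2 - 1) = p ^+ 2 * p ^+ 2 * (p ^+ 2 - 1) by ring.
    have p2 : 0 <= p ^+ 2 by rewrite sqr_ge0.
    apply: ler_pM; [exact: mulr_ge0|exact: w1| |by lra].
    by apply: (ler_wpM2l p2); lra.
  (* [H1] leaves about [- 4.32 p ^ 2]; [27 / 25] is a quarter of [4.32], so this term joins
     [2 p ^ 3] in a square. *)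
  have H2 : 0 <= 2 * p * (p - 27 / 25) ^+ 2 by apply: mulr_ge0; [lra|exact: sqr_ge0].
  nra.
have T3 : p ^+ 3 <= T ^+ 3 by rewrite lerXn2r ?nnegrE // ltW.
have key : 0 <= (p - 1) * (p ^+ 4 * (1 + p + p ^+ 2 - p ^+ 3) - 2).
  have -> : (p - 1) * (p ^+ 4 * (1 + p + p ^+ 2 - p ^+ 3) - 2) =
    (p - 1) ^+ 2 * (2 + 2 * p + 2 * p ^+ 2 + 2 * p ^+ 3 + p ^+ 4 - p ^+ 6) by ring.
  by rewrite mulr_ge0 ?sqr_ge0.
have B0 : 0 <= 1 + p + p ^+ 2 - p ^+ 3.
  have : 0 <= (7 / 4 - p) * p ^+ 2 by rewrite mulr_ge0 ?exprn_ge0 //; lra.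
  nra.
rewrite -subr_ge0.
(* The first summand uses [2 p <= q]; the second isolates the gain from [p <= T], and [key] is what
   remains at [T = p]. *)
have -> : T ^+ 2 * (p ^+ 2 - 1) + T^-1 * (q / p ^+ 2 - 2)
    - T ^+ 2 * p ^+ 2 * (p ^+ 2 - q + 1) =
  (T^-1 / p ^+ 2 + T ^+ 2 * p ^+ 2) * (q - 2 * p)
  + T^-1 / p * ((T ^+ 3 - p ^+ 3) * (p * ((p - 1) * (1 + p + p ^+ 2 - p ^+ 3)))
     + (p - 1) * (p ^+ 4 * (1 + p + p ^+ 2 - p ^+ 3) - 2)).
  by field; rewrite !lt0r_neq0.
have Ti : 0 <= T^-1 by rewrite invr_ge0 ltW.
rewrite addr_ge0 //.
  rewrite mulr_ge0 ?subr_ge0 // addr_ge0 ?divr_ge0 ?mulr_ge0 ?exprn_ge0 //; lra.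
rewrite mulr_ge0 ?divr_ge0 // ?addr_ge0 //; try lra.
by rewrite !mulr_ge0 ?subr_ge0 //; lra.
Qed.

(** * The tangent functional *)

Section Functional.
Variables (R : realType) (s r : R) (n : nat) (g1 g2 g3 : R).
Hypotheses (r_gt0 : 0 < r) (s_ge : n.+1%:R * r <= s) (s_lt : s < n.+2%:R * r).
Hypotheses (g21 : g2 <= g1) (g32 : g3 <= g2) (g_sum : g1 + g2 + g3 = 0).

(* [gap] is, up to a constant, the orbit sum minus a combination of power sums at
   the four wall points [- r], [s], [s + r] and [s - (n + 2) r] (see [gapE]).
   The weights make [(g1, g2, g3)] a critical point of [gap]: the derivative of
   [kern] is [scal * expR ((s - r) x)] times the error of the interpolation of
   [u ^ (n + 1)], [u = expR (- r x)], by a combination of [1], [u^-1] and [u^-2]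
   at the three points [g1], [g2], [g3]. *)
Definition hg : nat -> R :=
  hsym (expR (- r * g1)) (expR (- r * g2)) (expR (- r * g3)).
Definition scal : R := (s - r) / hg n.+2.

Definition coef_s : R :=
  scal * (psum r g1 g2 g3 * hg n.+1 - hg n) / s.
Definition coef_sr : R := scal * hg n.+1 / (s + r).
Definition coef_low : R := scal / (n.+2%:R * r - s).

Definition kern (x : R) : R :=
  coef_s * expR (s * x) - expR ((s - r) * x) - coef_sr * expR ((s + r) * x)
  - coef_low * expR ((s - n.+2%:R * r) * x).

Definition dpsum t a b c : R := psum t a b c - psum t g1 g2 g3.

Definition gap a b c : R :=
  dpsum s a b c * dpsum (- r) a b c + kern a + kern b + kern c.

(* The partial derivative of [gap], but for the term in [dpsum s]. Its exponentials
   all have exponents [s - k r >= 0], whence [slope_mono]. *)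
Definition slope (d1 d2 x : R) : R :=
  expR (s * x) *
  (s * d2 - scal * hg n.+1 * d1 + scal * tail hg d1 d2 (expR (- r * x)) n.+1).

Definition slope_at a b c x : R :=
  slope (dpsum r a b c) (dpsum (- r) a b c) x
  - r * dpsum s a b c * expR (- r * x).

Lemma s_gt0 : 0 < s.
Proof. by apply: lt_le_trans s_ge; rewrite mulr_gt0. Qed.

Lemma sr_ge0 : 0 <= s - r.
Proof.
by rewrite subr_ge0; apply: le_trans s_ge; rewrite ler_peMl ?ler1n // ltW.
Qed.

Lemma hg_gt0 k : 0 < hg k.+1.
Proof. by rewrite /hg hsym_gt0 ?expR_gt0. Qed.

Lemma hg_ge0 k : 0 <= hg k.
Proof. by rewrite /hg hsym_ge0 ?expR_gt0. Qed.

Lemma hg_growth k : expR (- r * g3) * hg k <= hg k.+1.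
Proof. by rewrite /hg hsym_growth ?expR_gt0. Qed.

Lemma scal_ge0 : 0 <= scal.
Proof. by rewrite /scal divr_ge0 ?sr_ge0 ?hg_ge0. Qed.

Lemma expR_prod a b c : a + b + c = 0 ->
  expR (- r * a) * expR (- r * b) * expR (- r * c) = 1.
Proof.
move=> sum0; rewrite -!expRD -expR0; congr expR.
by rewrite -!mulrDr sum0 mulr0.
Qed.

Lemma expR_pair a b c : a + b + c = 0 ->
  expR (r * a) = expR (- r * b) * expR (- r * c).
Proof.
move=> sum0; rewrite -expRD; congr expR.
have -> : a = - b - c by lra.
ring.
Qed.

Lemma hg1 : hg 1 = 1.
Proof. by rewrite /hg /= mulr0 add0r. Qed.

Lemma hg2 : hg 2 = psum (- r) g1 g2 g3.
Proof. by rewrite /hg /psum /= mulr0 add0r; ring. Qed.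

Lemma psum_pairs a b c : a + b + c = 0 -> psum r a b c =
  expR (- r * a) * expR (- r * b) + expR (- r * a) * expR (- r * c)
  + expR (- r * b) * expR (- r * c).
Proof.
move=> sum0; rewrite /psum (@expR_pair a b c) // (@expR_pair b a c); last lra.
rewrite (@expR_pair c a b); last lra.
ring.
Qed.

Lemma hg_rec k : hg k.+3 =
  psum (- r) g1 g2 g3 * hg k.+2 - psum r g1 g2 g3 * hg k.+1 + hg k.
Proof. by rewrite /hg hsym_rec expR_prod // psum_pairs // mul1r. Qed.

(** The numbers [expR (- r * xi)] are the roots of a cubic with coefficients [psum (- r)] and
    [psum r] at the moving triple, and their product is 1 because the exponents sum to 0. Hence
    [tail_root] evaluates the derivative of [kern]. *)
Lemma is_derive_gap b1 b2 b3 v1 v2 v3 (t : R) :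
    b1 + b2 + b3 = 0 -> v1 + v2 + v3 = 0 ->
    let x1 := b1 + t * v1 in let x2 := b2 + t * v2 in let x3 := b3 + t * v3 in
  is_derive t 1 (fun t => gap (b1 + t * v1) (b2 + t * v2) (b3 + t * v3))
    (v1 * slope_at x1 x2 x3 x1 + v2 * slope_at x1 x2 x3 x2
     + v3 * slope_at x1 x2 x3 x3).
Proof.
move=> b0 v0 x1 x2 x3.
have x0 : x1 + x2 + x3 = 0.
  have -> : x1 + x2 + x3 = (b1 + b2 + b3) + t * (v1 + v2 + v3).
    by rewrite /x1 /x2 /x3; ring.
  by rewrite b0 v0 mulr0 addr0.
pose d1 := dpsum r x1 x2 x3; pose d2 := dpsum (- r) x1 x2 x3.
pose dkern x := expR (s * x) * (s * coef_s - (s - r) * expR (- r * x)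
  - (s + r) * coef_sr * expR (r * x) + scal * expR (- r * x) ^+ n.+2).
have dkernE x y z : x + y + z = 0 -> psum r x y z = psum r x1 x2 x3 ->
   psum (- r) x y z = psum (- r) x1 x2 x3 ->
   slope d1 d2 x = dkern x + s * d2 * expR (s * x).
  move=> xyz0 E1 E2.
  suff : expR (s * x) * (- scal * hg n.+1 * d1 +
    scal * tail hg d1 d2 (expR (- r * x)) n.+1) = dkern x.
    by move=> <-; rewrite /slope; ring.
  have := @tail_root R hg (psum r g1 g2 g3) (psum (- r) g1 g2 g3)
    (psum r x y z) (psum (- r) x y z) (expR (- r * x)) n
    erefl hg1 hg2 hg_rec.
  rewrite E1 E2 -/d1 -/d2 => tailE.
  have -> : - scal * hg n.+1 * d1 + scal * tail hg d1 d2 (expR (- r * x)) n.+1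
    = scal * (- (hg n.+1 * d1) + tail hg d1 d2 (expR (- r * x)) n.+1) by ring.
  rewrite -tailE -?E1 -?E2; last first.
    rewrite psum_pairs // /psum.
    by rewrite -(expR_prod xyz0); ring.
  rewrite /dkern /coef_s /coef_sr.
  have -> : expR (r * x) = psum r x y z - psum (- r) x y z * expR (- r * x)
      + expR (- r * x) ^+ 2.
    by rewrite psum_pairs // (expR_pair xyz0) /psum; ring.
  have s0 := lt0r_neq0 s_gt0.
  have sr0 : s + r != 0 by rewrite lt0r_neq0 // addr_gt0 ?s_gt0.
  have -> : (s - r) * expR (- r * x) = scal * hg n.+2 * expR (- r * x).
    by rewrite /scal divfK // lt0r_neq0 ?hg_gt0.
  field.
  by rewrite s0 sr0.
have sl1 := dkernE x1 x2 x3 x0 erefl erefl.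
have sl2 : slope d1 d2 x2 = dkern x2 + s * d2 * expR (s * x2).
  by apply: (dkernE x2 x1 x3); rewrite ?/psum; [lra|ring|ring].
have sl3 : slope d1 d2 x3 = dkern x3 + s * d2 * expR (s * x3).
  by apply: (dkernE x3 x1 x2); rewrite ?/psum; [lra|ring|ring].
rewrite /slope_at -/d1 -/d2 sl1 sl2 sl3.
have E1 x : expR ((s - r) * x) = expR (s * x) * expR (- r * x).
  by rewrite -expRD; congr expR; ring.
have E2 x : expR ((s + r) * x) = expR (s * x) * expR (r * x).
  by rewrite -expRD; congr expR; ring.
have E3 x : expR ((s - n.+2%:R * r) * x) = expR (s * x) * expR (- r * x) ^+ n.+2.
  by rewrite -expRM_natl -expRD; congr expR; ring.
have lowE : coef_low * (s - n.+2%:R * r) = - scal.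
  have -> : s - n.+2%:R * r = - (n.+2%:R * r - s) by ring.
  by rewrite /coef_low mulrN divfK // subr_eq0 gt_eqF.
rewrite /gap /dpsum /psum /kern.
apply: is_derive_eq.
rewrite /GRing.scale /= -/x1 -/x2 -/x3 !E1 !E2 !E3.
rewrite /d2 /dpsum /psum /dkern.
have -> : scal = - (coef_low * (s - n.+2%:R * r)) by rewrite lowE opprK.
ring.
Qed.

(** * Monotonicity of [slope] *)

Lemma slope_linear a d1 d2 e1 e2 x :
  slope (d1 + a * e1) (d2 + a * e2) x = slope d1 d2 x + a * slope e1 e2 x.
Proof. by rewrite /slope tailD tailZ; ring. Qed.

(** Each level of [tail] lowers the exponent of the prefactor by [r]; [k * r <= q] keeps all of them
    nonnegative. *)
Lemma tail_expR_mono d1 d2 q k x y :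
    (forall i, 0 <= d2 * hg i.+1 - d1 * hg i) -> k%:R * r <= q -> x <= y ->
  expR (q * x) * tail hg d1 d2 (expR (- r * x)) k <=
  expR (q * y) * tail hg d1 d2 (expR (- r * y)) k.
Proof.
move=> d_ge0; elim: k q => [|k IHk] q kq xy; first by rewrite !mulr0.
have shift z T : expR (q * z) * (expR (- r * z) * T) = expR ((q - r) * z) * T.
  by rewrite mulrA -expRD -mulrDl.
rewrite 2!tailS; rewrite (shift x); rewrite (shift y); rewrite mulrDr [X in _ <= X]mulrDr.
have kq' : k%:R * r <= q - r by move: kq; rewrite -natr1; lra.
apply: lerD; first exact: IHk.
rewrite ler_wpM2r // ler_expR ler_wpM2l //.
by apply: le_trans kq'; rewrite mulr_ge0 // ltW.
Qed.

(** By [hg_growth] the bound on [d1] makes all coefficients of [tail] nonnegative; the leading one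
    follows from [s - r = scal * hg n.+2]. *)
Lemma slope_mono d1 d2 x y :
    0 <= d1 -> d1 <= expR (- r * g3) * d2 -> x <= y ->
  slope d1 d2 x <= slope d1 d2 y.
Proof.
move=> d1_ge0 d12 xy.
have d2_ge0 : 0 <= d2.
  by rewrite -(pmulr_rge0 _ (expR_gt0 (- r * g3))); apply: le_trans d12.
have coefs i : 0 <= d2 * hg i.+1 - d1 * hg i.
  rewrite subr_ge0; apply: (le_trans (ler_wpM2r (hg_ge0 i) d12)).
  by rewrite mulrAC mulrC ler_wpM2l ?hg_growth.
have top : 0 <= s * d2 - scal * hg n.+1 * d1.
  rewrite subr_ge0; apply: (@le_trans _ _ ((s - r) * d2)); last first.
    by rewrite ler_wpM2r // gerBl ltW.
  have -> : s - r = scal * hg n.+2 by rewrite /scal divfK // lt0r_neq0 ?hg_gt0.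
  by have := mulr_ge0 scal_ge0 (coefs n.+1); lra.
have slopeE z : slope d1 d2 z =
    expR (s * z) * (s * d2 - scal * hg n.+1 * d1)
    + scal * (expR (s * z) * tail hg d1 d2 (expR (- r * z)) n.+1).
  by rewrite /slope; ring.
rewrite !slopeE; apply: lerD.
  by rewrite ler_wpM2r // ler_expR ler_wpM2l // ltW ?s_gt0.
exact: (ler_wpM2l scal_ge0 (tail_expR_mono coefs s_ge xy)).
Qed.

(* Both sides are minus the value at [expR (- r * g3)] of the monic cubic with roots
   [expR (- r * a)], [expR (- r * b)] and [expR (- r * c)]. *)
Lemma dpsum_cubic a b c : a + b + c = 0 ->
  let k := expR (- r * g3) in
  k * (k * dpsum (- r) a b c - dpsum r a b c) =
  (k - expR (- r * a)) * (k - expR (- r * b)) * (expR (- r * c) - k).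
Proof.
move=> abc0 k; rewrite /dpsum !psum_pairs // /psum -/k.
have := expR_prod g_sum; have := expR_prod abc0; rewrite -/k.
set u1 := expR _; set u2 := expR _; set u3 := expR _.
set w1 := expR _; set w2 := expR _ => Hu Hw.
apply/eqP; rewrite -subr_eq0.
have -> : k * (k * (u1 + u2 + u3 - (w1 + w2 + k)) -
   (u1 * u2 + u1 * u3 + u2 * u3 - (w1 * w2 + w1 * k + w2 * k))) -
  (k - u1) * (k - u2) * (u3 - k) = w1 * w2 * k - u1 * u2 * u3 by ring.
by rewrite Hu Hw subrr.
Qed.

Lemma expRr_le x y : x <= y -> expR (- r * y) <= expR (- r * x).
Proof. by move=> xy; rewrite ler_expR ler_wnM2l // oppr_le0 ltW. Qed.

(** * Increments of [gap] along segments *)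

Lemma gap_incr b1 b2 b3 v1 v2 v3 :
    b1 + b2 + b3 = 0 -> v1 + v2 + v3 = 0 ->
    (forall t x1 x2 x3, 0 <= t <= 1 ->
      x1 = b1 + t * v1 -> x2 = b2 + t * v2 -> x3 = b3 + t * v3 ->
      0 <= v1 * slope_at x1 x2 x3 x1 + v2 * slope_at x1 x2 x3 x2
           + v3 * slope_at x1 x2 x3 x3) ->
  gap b1 b2 b3 <= gap (b1 + v1) (b2 + v2) (b3 + v3).
Proof.
move=> b0 v0 dge0.
have der t := is_derive_gap t b0 v0.
have cont : {within `[0, 1 : R],
    continuous (fun t => gap (b1 + t * v1) (b2 + t * v2) (b3 + t * v3))}%classic.
  apply: derivable_within_continuous => t _.
  exact: (@ex_derive _ _ _ _ _ _ _ (der t)).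
have [c c01] := MVT_segment (@ler01 R) (fun t _ => der t) cont.
rewrite !mul1r !mul0r !addr0 subr0 mulr1 -subr_ge0 => ->.
by apply: dge0 => //; move: c01; rewrite in_itv.
Qed.

Lemma slope_at_le a b c x y : slope (dpsum r a b c) (dpsum (- r) a b c) x <=
    slope (dpsum r a b c) (dpsum (- r) a b c) y -> x <= y ->
  0 <= dpsum s a b c ->
  slope_at a b c x <= slope_at a b c y.
Proof.
move=> slope_le xy ds; rewrite /slope_at lerB // ler_wpM2l ?expRr_le //.
by rewrite mulr_ge0 // ltW.
Qed.

Lemma dpsum_up t a b c : g1 <= a -> c <= g3 -> a + b + c = 0 ->
  0 <= dpsum t a b c.
Proof. by move=> ga cg abc0; rewrite subr_ge0 psum_mono // g_sum abc0. Qed.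

(** Along the segment the two larger exponents stay above [g3] and the last one below, so the
    product in [dpsum_cubic] is nonnegative and [slope_mono] applies. *)
Lemma gap_up a b c : g1 <= a -> c <= g3 -> g3 <= b -> b <= a -> a + b + c = 0 ->
  gap g1 g2 g3 <= gap a b c.
Proof.
move=> ga cg gb ba abc0.
have -> : gap a b c = gap (g1 + (a - g1)) (g2 + (b - g2)) (g3 + (c - g3)).
  by rewrite ![_ + (_ - _)]addrC !subrK.
apply: gap_incr; [exact: g_sum|by move: g_sum abc0; lra|].
move=> t x1 x2 x3 t01 x1E x2E x3E.
have x1g : g1 <= x1 by rewrite x1E; exact: lerp_ge.
have x3g : x3 <= g3 by rewrite x3E; exact: lerp_le_cst.
have x2g : g3 <= x2 by rewrite x2E; exact: lerp_ge.
have x21 : x2 <= x1 by rewrite x1E x2E; exact: lerp_le.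
have x0 : x1 + x2 + x3 = 0.
  have -> : x1 + x2 + x3 = (g1 + g2 + g3) * (1 - t) + t * (a + b + c).
    by rewrite x1E x2E x3E; ring.
  by rewrite g_sum abc0; ring.
have d1 := dpsum_up r x1g x3g x0.
have d12 : dpsum r x1 x2 x3 <= expR (- r * g3) * dpsum (- r) x1 x2 x3.
  rewrite -subr_ge0 -(pmulr_rge0 _ (expR_gt0 (- r * g3))) dpsum_cubic //.
  rewrite !mulr_ge0 // subr_ge0 expRr_le //; lra.
have ds := dpsum_up s x1g x3g x0.
have x32 : x3 <= x2 by exact: le_trans x2g.
apply: cone_ge0; [by rewrite subr_ge0|by rewrite subr_le0|by move: g_sum abc0; lra| |];
  by apply: slope_at_le => //; exact: slope_mono.
Qed.

Lemma gap_down a b c : a <= g1 -> g3 <= c -> c <= b -> b <= a -> a + b + c = 0 ->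
  gap g1 g2 g3 <= gap a b c.
Proof.
move=> ga cg cb ba abc0.
have -> : gap a b c = gap (g1 + (a - g1)) (g2 + (b - g2)) (g3 + (c - g3)).
  by rewrite ![_ + (_ - _)]addrC !subrK.
apply: gap_incr; [exact: g_sum|by move: g_sum abc0; lra|].
move=> t x1 x2 x3 t01 x1E x2E x3E.
have x1g : x1 <= g1 by rewrite x1E; exact: lerp_le_cst.
have x3g : g3 <= x3 by rewrite x3E; exact: lerp_ge.
have x32 : x3 <= x2 by rewrite x2E x3E; exact: lerp_le.
have x21 : x2 <= x1 by rewrite x1E x2E; exact: lerp_le.
have x0 : x1 + x2 + x3 = 0.
  have -> : x1 + x2 + x3 = (g1 + g2 + g3) * (1 - t) + t * (a + b + c).
    by rewrite x1E x2E x3E; ring.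
  by rewrite g_sum abc0; ring.
have neg q : 0 <= - dpsum q x1 x2 x3.
  by rewrite oppr_ge0 subr_le0 psum_mono // g_sum x0.
have d12 : - dpsum r x1 x2 x3 <= expR (- r * g3) * - dpsum (- r) x1 x2 x3.
  rewrite -subr_ge0 -(pmulr_rge0 _ (expR_gt0 (- r * g3))).
  have -> : expR (- r * g3) * (expR (- r * g3) * - dpsum (- r) x1 x2 x3
      - - dpsum r x1 x2 x3) = - (expR (- r * g3) *
      (expR (- r * g3) * dpsum (- r) x1 x2 x3 - dpsum r x1 x2 x3)) by ring.
  rewrite dpsum_cubic // -mulrN opprB.
  rewrite !mulr_ge0 // subr_ge0 expRr_le //; lra.
(* The [dpsum] are nonpositive here, so [slope_mono] is applied to their opposites; the displacement
   changes sign as well. *)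
pose w x := slope (- dpsum r x1 x2 x3) (- dpsum (- r) x1 x2 x3) x
  - r * (- dpsum s x1 x2 x3) * expR (- r * x).
have slopeN x : slope_at x1 x2 x3 x = - w x.
  have := slope_linear (- 1) 0 0 (dpsum r x1 x2 x3) (dpsum (- r) x1 x2 x3) x.
  have -> : slope 0 0 x = 0.
    have := slope_linear (- 1) 0 0 0 0 x; rewrite !mulr0 !addr0; lra.
  rewrite !add0r !mulN1r /w /slope_at => ->; ring.
have mono x y : x <= y -> w x <= w y.
  move=> xy; rewrite /w lerB ?slope_mono //.
  by rewrite ler_wpM2l ?expRr_le // mulr_ge0 // ltW.
have -> : (a - g1) * slope_at x1 x2 x3 x1 + (b - g2) * slope_at x1 x2 x3 x2 +
    (c - g3) * slope_at x1 x2 x3 x3 =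
    (g1 - a) * w x1 + (g2 - b) * w x2 + (g3 - c) * w x3.
  by rewrite !slopeN; ring.
apply: cone_ge0; [by rewrite subr_ge0|by rewrite subr_le0
  |by move: g_sum abc0; lra|exact: mono|exact: mono].
Qed.

(** * Two exponents below [g3] *)

Lemma tail01_le u k : 0 <= u <= expR (- r * g3) ->
  tail hg 0 1 u k <= k%:R * hg k.+1.
Proof.
move=> /andP[u0 u_le]; elim: k => [|k IHk]; first by rewrite mul0r.
rewrite tailS mul1r mul0r subr0.
have step : u * hg k.+1 <= hg k.+2.
  by apply: le_trans (hg_growth k.+1); rewrite ler_wpM2r ?hg_ge0.
apply: (@le_trans _ _ (k.+1%:R * (u * hg k.+1))); last by rewrite ler_wpM2l.
by have := ler_wpM2l u0 IHk; rewrite -natr1; lra.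
Qed.

(** Convexity: [(exp (q d) - 1) / q] increases with [q], here from [r] to [s], with [d = g3 - x]. *)
Lemma scale_expR_le x : x <= g3 ->
  s * (expR (- r * x) - expR (- r * g3)) <=
  r * (expR (- r * g3) * (expR (s * (g3 - x)) - 1)).
Proof.
move=> xg; set y := expR (r * (g3 - x)); set E := expR (s * (g3 - x)).
have -> : expR (- r * x) = expR (- r * g3) * y.
  by rewrite -expRD; congr expR; ring.
have -> : s * (expR (- r * g3) * y - expR (- r * g3)) =
  expR (- r * g3) * (s * (y - 1)) by ring.
rewrite [r * _]mulrCA ler_wpM2l ?expR_ge0 //.
have H1 := expR_tangent (r * (g3 - x)) (s * (g3 - x)).
have H0 := expR_tangent (r * (g3 - x)) 0.
rewrite expR0 -/y -/E in H1 H0.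
have sr := sr_ge0.
have := ler_wpM2l (ltW r_gt0) H1; have := ler_wpM2l sr H0.
lra.
Qed.

(* When two exponents lie below [g3] the coefficients of [slope] may be negative;
   the defect [eps] is then absorbed by the [dpsum s] term of [slope_at]. *)
Lemma slope_at_far x1 x2 x3 : x1 + x2 + x3 = 0 -> x2 <= g3 -> x3 <= g3 ->
    expR (s * x1) * ((expR (s * (g3 - x2)) - 1) * (expR (s * (g3 - x3)) - 1))
      <= dpsum s x1 x2 x3 ->
  slope_at x1 x2 x3 x2 <= slope_at x1 x2 x3 x1.
Proof.
move=> x0 x2g x3g ds_ge.
have g3_le0 : g3 <= 0 by move: g_sum g21 g32; lra.
have x1g : g1 <= x1 by move: g_sum x0 g21 g32; lra.
have x31 : g3 <= x1 by move: g21 g32; lra.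
set k := expR (- r * g3); set U1 := expR (- r * x1).
set U2 := expR (- r * x2); set U3 := expR (- r * x3); set F := expR (s * x1).
set d1 := dpsum r x1 x2 x3; set d2 := dpsum (- r) x1 x2 x3.
set ds := dpsum s x1 x2 x3 in ds_ge *.
have k0 : 0 < k by exact: expR_gt0.
have F0 : 0 < F by exact: expR_gt0.
have kU1 : U1 <= k by exact: expRr_le.
have kU2 : k <= U2 by exact: expRr_le.
have kU3 : k <= U3 by exact: expRr_le.
have d1_ge0 : 0 <= d1 by exact: dpsum_up.
(* With [d1 / k] in place of [d2], [slope_mono] applies with equality in its hypothesis; [eps] is
   the cost of this change. *)
pose eps := d1 / k - d2.
have epsE : k ^+ 2 * eps = (k - U1) * ((U2 - k) * (U3 - k)).
  have := dpsum_cubic x0; rewrite -/k -/U1 -/U2 -/U3 -/d1 -/d2 => E.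
  have -> : (k - U1) * ((U2 - k) * (U3 - k)) = - ((k - U1) * (k - U2) * (U3 - k)).
    by ring.
  by rewrite -E /eps; field; rewrite lt0r_neq0.
have eps_ge0 : 0 <= eps.
  rewrite -(pmulr_rge0 _ (exprn_gt0 2 k0)) epsE !mulr_ge0 ?subr_ge0 //.
have slopeE x : slope d1 d2 x = slope d1 (d1 / k) x -
    eps * (expR (s * x) * (s + scal * tail hg 0 1 (expR (- r * x)) n.+1)).
  have -> : d2 = d1 / k + - eps * 1 by rewrite /eps; ring.
  have {1}-> : d1 = d1 + - eps * 0 by ring.
  by rewrite slope_linear {2}/slope; ring.
have far_le : scal * tail hg 0 1 U1 n.+1 <= (s - r) * n.+1%:R.
  have -> : s - r = scal * hg n.+2 by rewrite /scal divfK // lt0r_neq0 ?hg_gt0.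
  have U1k : 0 <= U1 <= k by rewrite expR_ge0.
  by have := ler_wpM2l scal_ge0 (tail01_le n.+1 U1k); lra.
have near_ge : 0 <= eps * (expR (s * x2) * (s + scal * tail hg 0 1 U2 n.+1)).
  rewrite !mulr_ge0 ?expR_ge0 // addr_ge0 ?(ltW s_gt0) // mulr_ge0 ?scal_ge0 //.
  have : 0 <= U2 by exact: expR_ge0.
  elim: (n.+1) => // i IHi u0; rewrite tailS mul1r mul0r subr0.
  by rewrite mulr_ge0 // addr_ge0 ?IHi ?hg_ge0.
have main : slope d1 (d1 / k) x2 <= slope d1 (d1 / k) x1.
  apply: slope_mono => //; last by lra.
  by rewrite mulrCA mulfV ?mulr1 // lt0r_neq0.
suff far : eps * (F * (s + (s - r) * n.+1%:R)) <= r * ds * (U2 - U1).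
  rewrite /slope_at -/d1 -/d2 -/ds !slopeE -/U1 -/U2 -/F.
  have : eps * (F * (s + scal * tail hg 0 1 U1 n.+1)) <=
     eps * (F * (s + (s - r) * n.+1%:R)).
    by apply: (ler_wpM2l eps_ge0); apply: (ler_wpM2l (ltW F0)); rewrite lerD2l.
  lra.
have ds_ge0 : 0 <= ds by exact: dpsum_up.
apply: (@le_trans _ _ (r * ds * (k - U1))); last first.
  by rewrite ler_wpM2l ?lerD2r // mulr_ge0 // ltW.
rewrite -(ler_pM2l (mulr_gt0 r_gt0 (exprn_gt0 2 k0))).
have -> : r * k ^+ 2 * (eps * (F * (s + (s - r) * n.+1%:R))) =
  (k ^+ 2 * eps) * (F * (r * s + (s - r) * (n.+1%:R * r))) by ring.
rewrite epsE.
have H2 := scale_expR_le x2g; have H3 := scale_expR_le x3g.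
rewrite -/k -/U2 -/U3 in H2 H3.
(* The defect thus carries at most [s ^ 2], one factor [s] for each use of [scale_expR_le]. *)
have sq : r * s + (s - r) * (n.+1%:R * r) <= s * s.
  have := ler_wpM2l sr_ge0 s_ge; lra.
apply: (@le_trans _ _ ((k - U1) * ((U2 - k) * (U3 - k)) * (F * (s * s)))).
  by rewrite !ler_wpM2l ?(ltW F0) // !mulr_ge0 ?subr_ge0.
set e2 := expR _ - 1 in ds_ge H2; set e3 := expR _ - 1 in ds_ge H3.
have prod_le : s * (U2 - k) * (s * (U3 - k)) <= r * (k * e2) * (r * (k * e3)).
  by apply: ler_pM => //; rewrite mulr_ge0 ?subr_ge0 // ltW ?s_gt0.
apply: (@le_trans _ _ ((k - U1) * F * (r * (k * e2) * (r * (k * e3))))).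
  have -> : (k - U1) * ((U2 - k) * (U3 - k)) * (F * (s * s)) =
    (k - U1) * F * (s * (U2 - k) * (s * (U3 - k))) by ring.
  by rewrite ler_wpM2l // mulr_ge0 ?subr_ge0 // ltW.
have -> : (k - U1) * F * (r * (k * e2) * (r * (k * e3))) =
  r * k ^+ 2 * r * (k - U1) * (F * (e2 * e3)) by ring.
have -> : r * k ^+ 2 * (r * ds * (k - U1)) = r * k ^+ 2 * r * (k - U1) * ds by ring.
by rewrite ler_wpM2l // !mulr_ge0 ?subr_ge0 ?exprn_ge0 // ltW.
Qed.

Lemma gap_far l1 l2 l3 : l1 + l2 + l3 = 0 -> l3 <= l2 -> l2 <= g3 ->
    l1 <= - 4 * g3 -> expR (s * ((l1 + 2 * g3) / 2)) <= 7 / 4 ->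
  gap g1 g2 g3 <= gap l1 l2 l3.
Proof.
move=> l0 l32 l2g l1g p74.
have g3_le0 : g3 <= 0 by move: g_sum g21 g32; lra.
have s0 := s_gt0.
(* The path goes through a corner beyond which both lower exponents stay at or below [g3]. *)
apply: (@le_trans _ _ (gap (- 2 * g3) g3 g3)).
  by apply: gap_up => //; move: g_sum g21 g32; lra.
have E1 : - 2 * g3 + (l1 + 2 * g3) = l1 by ring.
have E x : g3 + (x - g3) = x by ring.
rewrite -E1 -[l2]E -[l3]E.
apply: gap_incr; [lra|lra|].
move=> t x1 x2 x3 t01 x1E x2E x3E; have /andP[t_ge0 t_le1] := t01.
have x0 : x1 + x2 + x3 = 0.
  have -> : x1 + x2 + x3 = t * (l1 + l2 + l3) by rewrite x1E x2E x3E; ring.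
  by rewrite l0 mulr0.
have x2g : x2 <= g3 by rewrite x2E; apply: lerp_le_cst.
have x3g : x3 <= g3 by rewrite x3E; apply: lerp_le_cst => //; lra.
have x1l : x1 <= l1.
  have -> : l1 = - 2 * g3 + 1 * (l1 + 2 * g3) by ring.
  by rewrite x1E lerD2l ler_wpM2r //; lra.
pose T := expR (- (s * g3)); pose p := expR (s * ((x1 + 2 * g3) / 2)).
pose a := expR (s * (g3 - x2)); pose b := expR (s * (g3 - x3)).
have num : T ^+ 2 * (a * b) * ((a - 1) * (b - 1)) <=
    T ^+ 2 * (a * b - 1) + T^-1 * (a^-1 + b^-1 - 2).
  have exp_ge1 (y : R) : 0 <= y -> 1 <= expR y.
    by move=> y0; rewrite -expR0 ler_expR.
  apply: (@far_increment_bound _ T p).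
  - by apply: exp_ge1; rewrite mulr_ge0 ?subr_ge0 // ltW.
  - by apply: exp_ge1; rewrite mulr_ge0 ?subr_ge0 // ltW.
  - apply: exp_ge1; rewrite mulr_ge0 ?(ltW s0) //; lra.
  - rewrite /p /a /b -expRM_natl -expRD; congr expR.
    have -> : x1 = - x2 - x3 by lra.
    by field.
  - by rewrite ler_expR -mulrN ler_wpM2l ?(ltW s0) //; lra.
  - by apply: le_trans p74; rewrite ler_expR ler_wpM2l ?(ltW s0) //; lra.
have F1E : expR (s * x1) = T ^+ 2 * (a * b).
  rewrite /T /a /b -expRM_natl -!expRD; congr expR.
  have -> : x1 = - x2 - x3 by lra.
  by ring.
have F2E : expR (s * x2) = T^-1 * a^-1.
  by rewrite /T /a -!expRN -expRD; congr expR; ring.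
have F3E : expR (s * x3) = T^-1 * b^-1.
  by rewrite /T /b -!expRN -expRD; congr expR; ring.
have ds : T ^+ 2 * (a * b) * ((a - 1) * (b - 1)) <= dpsum s x1 x2 x3.
  apply: (le_trans num).
  have : psum s g1 g2 g3 <= psum s (- 2 * g3) g3 g3.
    by apply: psum_mono => //; move: g_sum g21 g32; lra.
  have -> : psum s (- 2 * g3) g3 g3 = T ^+ 2 + T^-1 + T^-1.
    rewrite /psum /T -expRM_natl -expRN.
    by congr (_ + _ + _); congr expR; ring.
  by rewrite /dpsum {2}/psum F1E F2E F3E; lra.
have le12 : slope_at x1 x2 x3 x2 <= slope_at x1 x2 x3 x1.
  by apply: slope_at_far => //; rewrite F1E.
have le13 : slope_at x1 x2 x3 x3 <= slope_at x1 x2 x3 x1.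
  have swap q : dpsum q x1 x2 x3 = dpsum q x1 x3 x2 by rewrite /dpsum /psum; ring.
  rewrite /slope_at !swap -/(slope_at x1 x3 x2 x3) -/(slope_at x1 x3 x2 x1).
  apply: slope_at_far => //; first by lra.
  by rewrite F1E -swap; move: ds; rewrite [(a - 1) * _]mulrC.
have -> : (l1 + 2 * g3) * slope_at x1 x2 x3 x1 +
    (l2 - g3) * slope_at x1 x2 x3 x2 + (l3 - g3) * slope_at x1 x2 x3 x3 =
  (g3 - l2) * (slope_at x1 x2 x3 x1 - slope_at x1 x2 x3 x2) +
  (g3 - l3) * (slope_at x1 x2 x3 x1 - slope_at x1 x2 x3 x3).
  have -> : l1 = - l2 - l3 by lra.
  by ring.
by rewrite addr_ge0 // mulr_ge0 ?subr_ge0 //; lra.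
Qed.

(** * Signs of the weights, and the inequality for [0 < r <= s] *)

Lemma coef_s_le : coef_s <= psum (- r) g1 g2 g3.
Proof.
have s0 := s_gt0; have p0 : 0 <= psum (- r) g1 g2 g3.
  by rewrite /psum !addr_ge0 ?expR_ge0.
rewrite /coef_s ler_pdivrMr //.
(* The recurrence shows that [coef_s] is [(s - r) / s] times [psum (- r)] at [g], minus a
   nonnegative term. *)
have -> : psum r g1 g2 g3 * hg n.+1 - hg n =
  psum (- r) g1 g2 g3 * hg n.+2 - hg n.+3 by rewrite hg_rec; ring.
have E : scal * hg n.+2 = s - r by rewrite /scal divfK // lt0r_neq0 ?hg_gt0.
have -> : scal * (psum (- r) g1 g2 g3 * hg n.+2 - hg n.+3) =
  psum (- r) g1 g2 g3 * (scal * hg n.+2) - scal * hg n.+3 by ring.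
rewrite E; have := mulr_ge0 scal_ge0 (hg_ge0 n.+3).
by have := mulr_ge0 p0 (ltW r_gt0); lra.
Qed.

Lemma coef_sr_ge0 : 0 <= coef_sr.
Proof.
apply: divr_ge0; first exact: (mulr_ge0 scal_ge0 (hg_ge0 _)).
by rewrite addr_ge0 // ltW ?s_gt0.
Qed.

Lemma coef_low_ge0 : 0 <= coef_low.
Proof. by rewrite divr_ge0 ?scal_ge0 // subr_ge0 ltW. Qed.

Lemma gapE a b c : gap a b c = jsum s r a b c
  - psum s g1 g2 g3 * psum (- r) a b c
  - (psum (- r) g1 g2 g3 - coef_s) * psum s a b c
  - coef_sr * psum (s + r) a b c
  - coef_low * psum (s - n.+2%:R * r) a b c
  + psum s g1 g2 g3 * psum (- r) g1 g2 g3.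
Proof. by rewrite jsumE /gap /kern /dpsum /psum; ring. Qed.

(** The sum of the two [gap] inequalities, written by [gapE], reduces the claim to the [psum]
    hypothesis at the four wall points, whose weights are nonnegative. *)
Lemma jsum_of_gap l1 l2 l3 m1 m2 m3 :
    gap g1 g2 g3 <= gap l1 l2 l3 -> gap g1 g2 g3 <= gap m1 m2 m3 ->
    (forall t, 2 * psum t g1 g2 g3 <= psum t l1 l2 l3 + psum t m1 m2 m3) ->
  2 * jsum s r g1 g2 g3 <= jsum s r l1 l2 l3 + jsum s r m1 m2 m3.
Proof.
move=> gl gm Q; move: gl gm; rewrite !gapE => gl gm.
have p0 : 0 <= psum s g1 g2 g3 by rewrite /psum !addr_ge0 ?expR_ge0.
have := ler_wpM2l p0 (Q (- r)).
have := ler_wpM2l (ltac:(rewrite subr_ge0; exact: coef_s_le) :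
  0 <= psum (- r) g1 g2 g3 - coef_s) (Q s).
have := ler_wpM2l coef_sr_ge0 (Q (s + r)).
have := ler_wpM2l coef_low_ge0 (Q (s - n.+2%:R * r)).
lra.
Qed.

(* [gap] need not increase all the way to a distant [l], but there the orbit sum
   at [l] alone already exceeds twice the one at [g], up to its minimum [6]. *)
Lemma jsum_far l1 l2 l3 m1 m2 m3 : l1 + l2 + l3 = 0 -> l3 <= l2 -> l2 <= g3 ->
    m1 + m2 + m3 = 0 -> m3 <= m2 -> m2 <= m1 ->
    (gap g1 g2 g3 <= gap l1 l2 l3 ->
     2 * jsum s r g1 g2 g3 <= jsum s r l1 l2 l3 + jsum s r m1 m2 m3) ->
  2 * jsum s r g1 g2 g3 <= jsum s r l1 l2 l3 + jsum s r m1 m2 m3.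
Proof.
move=> l0 l32 l2g m0 m32 m21 near_case.
have s0 := s_gt0; have s_ge0 := ltW s0; have r_ge0 := ltW r_gt0.
have g3_le0 : g3 <= 0 by move: g_sum g21 g32; lra.
case: (leP l1 (- 4 * g3)) => [l1g|l1g]; last first.
  (* Beyond [- 4 g3] the triple [l] dominates [2 g], and [2 v <= v ^ 2 + 1] concludes term by
     term. *)
  have Jl : jsum s r (2 * g1) (2 * g2) (2 * g3) <= jsum s r l1 l2 l3.
    by apply: jsum_mono => //; move: g_sum g21 g32; lra.
  have Jm : jsum s r 0 0 0 <= jsum s r m1 m2 m3 by apply: jsum_mono => //; lra.
  have dbl x y : 2 * expR (s * x - r * y) <= expR (s * (2 * x) - r * (2 * y)) + 1.
    have -> : expR (s * (2 * x) - r * (2 * y)) = expR (s * x - r * y) ^+ 2.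
      by rewrite -expRM_natl; congr expR; ring.
    by have := sqr_ge0 (expR (s * x - r * y) - 1); lra.
  have J0 : jsum s r 0 0 0 = 6.
    by rewrite /jsum !mulr0 subrr expR0; ring.
  rewrite J0 in Jm.
  have := (dbl g1 g2, dbl g1 g3, dbl g2 g1, dbl g2 g3, dbl g3 g1, dbl g3 g2).
  case=> [[[[[]]]]]; rewrite /jsum in Jl Jm *; lra.
case: (leP (expR (s * ((l1 + 2 * g3) / 2))) (7 / 4)) => [p74|p74].
  by apply: near_case; exact: gap_far.
pose T := expR (- (s * g3)); pose p := expR (s * ((l1 + 2 * g3) / 2)).
pose k := expR (- r * g3).
have k0 : 0 < k by exact: expR_gt0.
have T0 : 0 < T by exact: expR_gt0.
have pT : p <= T by rewrite ler_expR -mulrN ler_wpM2l //; lra.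
have Jl : 2 * (T ^+ 2 * p ^+ 2 * k) <= jsum s r l1 l2 l3.
  have F1E : expR (s * l1) = T ^+ 2 * p ^+ 2.
    by rewrite /T /p -!expRM_natl -expRD; congr expR; field.
  have H2 : k <= expR (- r * l2) by exact: expRr_le.
  have H3 : k <= expR (- r * l3) by apply: expRr_le; lra.
  have E y : expR (s * l1 - r * y) = T ^+ 2 * p ^+ 2 * expR (- r * y).
    by rewrite -F1E -expRD mulNr.
  have Tp : 0 <= T ^+ 2 * p ^+ 2 by rewrite -F1E expR_ge0.
  have := ler_wpM2l Tp H2; have := ler_wpM2l Tp H3.
  have := (expR_ge0 (s * l2 - r * l1), expR_ge0 (s * l2 - r * l3),
           expR_ge0 (s * l3 - r * l1), expR_ge0 (s * l3 - r * l2)).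
  by case=> [[[]]]; rewrite /jsum !E; lra.
have Jg : jsum s r g1 g2 g3 <= 2 * (T ^+ 2 * k) + 4 * (T^-1 * k).
  have : jsum s r g1 g2 g3 <= jsum s r (- 2 * g3) g3 g3.
    by apply: jsum_mono => //; move: g_sum g21 g32; lra.
  have E1 : expR (s * (- 2 * g3) - r * g3) = T ^+ 2 * k.
    by rewrite /T /k -expRM_natl -expRD; congr expR; ring.
  have E2 : expR (s * g3 - r * g3) = T^-1 * k.
    by rewrite /T /k -expRN -expRD; congr expR; ring.
  have E3 : expR (s * g3 - r * (- 2 * g3)) <= T^-1 * k.
    rewrite /T /k -expRN -expRD ler_expR.
    by have := mulr_ge0_le0 r_ge0 g3_le0; lra.
  by rewrite /jsum E1 E2; lra.
have Jm : 0 <= jsum s r m1 m2 m3 by rewrite /jsum !addr_ge0 ?expR_ge0.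
(* [7 / 4] exceeds the square root of 3. From [3 <= p ^ 2] and [4 <= T ^ 3], [2 T ^ 2 p ^ 2 k] is at
   least [4 T ^ 2 k + 8 k / T]. *)
have p2 : 3 <= p ^+ 2 by rewrite -/p in p74; nra.
have T3 : 4 <= T ^+ 3.
  have p3 : 4 <= p ^+ 3.
    have -> : p ^+ 3 = p * p ^+ 2 by ring.
    by rewrite -/p in p74; nra.
  by apply: (le_trans p3); rewrite lerXn2r ?nnegrE ?expR_ge0.
have Tinv : 4 * T^-1 <= T ^+ 2.
  by rewrite ler_pdivrMr // -exprSr.
have := ler_wpM2l (ltW k0) Tinv.
have := ler_wpM2l (mulr_ge0 (exprn_ge0 2 (ltW T0)) (ltW k0)) p2.
lra.
Qed.

Lemma jsum_main l1 l2 l3 m1 m2 m3 :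
    l1 + l2 + l3 = 0 -> l3 <= l2 -> l2 <= l1 -> g1 <= l1 -> l3 <= g3 ->
    m1 + m2 + m3 = 0 -> m3 <= m2 -> m2 <= m1 -> m1 <= g1 -> g3 <= m3 ->
    (forall t, 2 * psum t g1 g2 g3 <= psum t l1 l2 l3 + psum t m1 m2 m3) ->
  2 * jsum s r g1 g2 g3 <= jsum s r l1 l2 l3 + jsum s r m1 m2 m3.
Proof.
move=> l0 l32 l21 gl1 lg3 m0 m32 m21 mg1 gm3 Q.
have gap_m : gap g1 g2 g3 <= gap m1 m2 m3 by exact: gap_down.
case: (leP g3 l2) => [gl2|lg2].
  by apply: jsum_of_gap => //; exact: gap_up.
by apply: jsum_far => // [|gap_l]; [exact: ltW|exact: jsum_of_gap].
Qed.

End Functional.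

(** * From orbit sums to exponential sums *)

Section Reduction.
Variable R : realType.
Implicit Types (s r x y z t : R).

(** Inverting the variables negates the exponents and exchanges [s] and [r]. *)
Lemma jsum_rev s r (a b c : R) : jsum s r a b c = jsum r s (- c) (- b) (- a).
Proof.
rewrite /jsum.
have E u v : expR (s * u - r * v) = expR (r * - v - s * - u).
  by congr expR; ring.
by rewrite !E; ring.
Qed.

Lemma psum_rev t (a b c : R) : psum t a b c = psum (- t) (- c) (- b) (- a).
Proof. by rewrite /psum !mulrNN; ring. Qed.

Lemma jsum_ge s r (l1 l2 l3 g1 g2 g3 m1 m2 m3 : R) : 0 <= s -> 0 <= r ->
    l1 + l2 + l3 = 0 -> l3 <= l2 -> l2 <= l1 ->
    g1 + g2 + g3 = 0 -> g3 <= g2 -> g2 <= g1 ->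
    m1 + m2 + m3 = 0 -> m3 <= m2 -> m2 <= m1 ->
    g1 <= l1 -> l3 <= g3 -> m1 <= g1 -> g3 <= m3 ->
    (forall t, 2 * psum t g1 g2 g3 <= psum t l1 l2 l3 + psum t m1 m2 m3) ->
  2 * jsum s r g1 g2 g3 <= jsum s r l1 l2 l3 + jsum s r m1 m2 m3.
Proof.
wlog sr : s r l1 l2 l3 g1 g2 g3 m1 m2 m3 / r <= s.
  move=> wlog_sr s0 r0 l0 l32 l21 g0 g32 g21 m0 m32 m21 gl1 lg3 mg1 gm3 Q.
  case: (leP r s) => [sr|/ltW rs]; first exact: wlog_sr.
  rewrite !(jsum_rev s); apply: wlog_sr => //; rewrite ?lerN2 //; try lra.
  by move=> t; have := Q (- t); rewrite !(psum_rev (- t)) opprK.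
move=> s0 r0 l0 l32 l21 g0 g32 g21 m0 m32 m21 gl1 lg3 mg1 gm3 Q.
(* For [r = 0] two variables coincide, and the hypothesis at [s] suffices. *)
case: (eqVneq r 0) => [->|r_neq0].
  have wall (a b c : R) : jsum s 0 a b c = 2 * psum s a b c.
    by rewrite /jsum /psum !mul0r !subr0; ring.
  by rewrite !wall; have := Q s; lra.
have r_gt0 : 0 < r by rewrite lt_def r_neq0.
have /andP[n_le n_lt] : (Num.trunc (s / r))%:R <= s / r
    < (Num.trunc (s / r)).+1%:R by rewrite truncn_itv // divr_ge0.
rewrite ler_pdivlMr // in n_le; rewrite ltr_pdivrMr // in n_lt.
(* The integral part of [s / r] is at least 1 because [r <= s]; it is [n.+1] in the previous
   section. *)
case: (Num.trunc _) n_le n_lt => [|n] n_le n_lt.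
  by move: n_lt; rewrite mul1r ltNge sr.
exact: (jsum_main r_gt0 n_le n_lt).
Qed.

(** * Orbit sums in logarithmic coordinates *)

Let o0 : 'I_3 := @Ordinal 3 0 isT.
Let o1 : 'I_3 := @Ordinal 3 1 isT.
Let o2 : 'I_3 := @Ordinal 3 2 isT.

Lemma sum_S3 (V : nmodType) (F : 'I_3 -> 'I_3 -> 'I_3 -> V) :
  \sum_(s : 'S_3) F (s o0) (s o1) (s o2) =
  F o0 o1 o2 + F o0 o2 o1 + F o1 o0 o2 + F o1 o2 o0 + F o2 o0 o1 + F o2 o1 o0.
Proof.
pose S : seq 'S_3 := [:: 1%g; tperm o1 o2; tperm o0 o1;
  (tperm o0 o1 * tperm o0 o2)%g; (tperm o0 o2 * tperm o0 o1)%g; tperm o0 o2].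
(* The images of [o0] and [o1] tell the six permutations apart; the cardinal [3!] then shows that
   the list is complete. *)
have S_uniq : uniq S.
  apply: (@map_uniq _ _ (fun s : 'S_3 => (val (s o0), val (s o1)))).
  by rewrite /= !permM !permE.
have S_all : perm_eq (index_enum 'S_3) S.
  rewrite perm_sym uniq_perm ?index_enum_uniq // => s; rewrite mem_index_enum.
  have S_card : #|S| = #|'S_3| by rewrite (card_uniqP S_uniq) card_Sn.
  by have /(subset_cardP S_card) -> : S \subset {perm 'I_3} by exact: subset_predT.
by rewrite (perm_big _ S_all) /= !big_cons big_nil !permM !permE /= addr0 !addrA.
Qed.

Definition exponent (eta : 3.-tuple rat) i : R := ratr eta`_i.

Lemma orbit_sumE eta x y z : orbit_sum eta x y z =
  let p (w : R) i := w `^ exponent eta i in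
  p x 0 * p y 2 * p z 1 + p x 0 * p y 1 * p z 2 + p x 1 * p y 2 * p z 0
  + p x 1 * p y 0 * p z 2 + p x 2 * p y 1 * p z 0 + p x 2 * p y 0 * p z 1.
Proof.
rewrite /orbit_sum /=.
pose F i j k : R := x `^ ratr (tnth eta i) * y `^ ratr (tnth eta j)
  * z `^ ratr (tnth eta k).
transitivity (\sum_(s : 'S_3) F (s o0) (s o1) (s o2)).
  apply: eq_bigr => s _; rewrite !big_ord_recr big_ord0 /= mul1r /F.
  rewrite !(tnth_nth 0) /=.
  by congr (_ `^ ratr (nth _ _ (s _)) * _ `^ ratr (nth _ _ (s _))
    * _ `^ ratr (nth _ _ (s _))); apply: val_inj.
by rewrite sum_S3 /F !(tnth_nth 0) /exponent /=; ring.
Qed.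

Lemma P_fun_swap12 l g m x y z : P_fun l g m x y z = P_fun l g m y x z.
Proof. by rewrite /P_fun !orbit_sumE /=; ring. Qed.

Lemma P_fun_swap23 l g m x y z : P_fun l g m x y z = P_fun l g m x z y.
Proof. by rewrite /P_fun !orbit_sumE /=; ring. Qed.

Lemma P_fun_wall l g m t : P_fun l g m t 1 1 = 2 * Q_fun l g m t.
Proof.
rewrite /P_fun /Q_fun !orbit_sumE /= !powR1 !big_ord_recr !big_ord0 /=.
by rewrite !(tnth_nth 0) /exponent /=; ring.
Qed.

Lemma powR_exp x (e : R) : 0 < x -> x `^ e = expR (e * ln x).
Proof. by move=> x0; rewrite /powR gt_eqF. Qed.

Definition mean eta : R := (exponent eta 0 + exponent eta 1 + exponent eta 2) / 3.
Definition centred eta i : R := exponent eta i - mean eta.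

Lemma centred_sum eta : centred eta 0 + centred eta 1 + centred eta 2 = 0.
Proof. by rewrite /centred /mean; field. Qed.

(** The centred exponents see only the ratios of the variables, and the mean only their product. *)
Lemma orbit_sum_jsum eta x y z : 0 < x -> 0 < y -> 0 < z ->
  orbit_sum eta x y z = expR (mean eta * (ln x + ln y + ln z)) *
  jsum (ln x - ln y) (ln y - ln z) (centred eta 0) (centred eta 1) (centred eta 2).
Proof.
move=> x0 y0 z0; rewrite orbit_sumE /= !powR_exp // -!expRD /jsum.
rewrite !mulrDr -!expRD /centred /mean.
by congr (_ + _ + _ + _ + _ + _); congr expR; field.
Qed.

Lemma Q_fun_psum eta t : 0 < t ->
  \sum_(i < 3) t `^ ratr (tnth eta i) =
  expR (mean eta * ln t) *
  psum (ln t) (centred eta 0) (centred eta 1) (centred eta 2).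
Proof.
move=> t0; rewrite !big_ord_recr big_ord0 /= !(tnth_nth 0) /= add0r.
rewrite !powR_exp // /psum !mulrDr -!expRD /centred.
by congr (_ + _ + _); congr expR; rewrite /exponent; ring.
Qed.

End Reduction.

(** * The theorem for rational triples *)

Lemma weakly_decreasing_nth (a : 3.-tuple rat) :
  weakly_decreasing a -> a`_1 <= a`_0 /\ a`_2 <= a`_1.
Proof.
by case: a => -[|a0 [|a1 [|a2 []]]] //= ?; rewrite /weakly_decreasing /= => /and3P[].
Qed.

Lemma triple_sumE (a : 3.-tuple rat) : triple_sum a = a`_0 + a`_1 + a`_2.
Proof.
by rewrite /triple_sum !big_ord_recr big_ord0 /= !(tnth_nth 0) /= add0r.
Qed.

Lemma centred_decr (R : realType) (a : 3.-tuple rat) : weakly_decreasing a ->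
  centred R a 1 <= centred R a 0 /\ centred R a 2 <= centred R a 1.
Proof.
by move=> /weakly_decreasing_nth[a10 a21]; split; rewrite lerD2r ler_rat.
Qed.

Lemma meanE (R : realType) (a : 3.-tuple rat) :
  mean R a = ratr (triple_sum a) / 3.
Proof. by rewrite triple_sumE /mean /exponent !rmorphD. Qed.

Lemma centred_dominates (R : realType) (a b : 3.-tuple rat) :
    triple_sum a = triple_sum b -> dominates a b ->
  centred R b 0 <= centred R a 0 /\ centred R a 2 <= centred R b 2.
Proof.
move=> ab [ab0 ab01]; rewrite /centred !meanE ab; split; rewrite lerD2r ler_rat //.
by move: ab; rewrite !triple_sumE => ab; lra.
Qed.

Theorem corollary13p1 (R : realType) (lambda gamma mu : 3.-tuple rat)
  (lambda_decr : weakly_decreasing lambda)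
  (gamma_decr : weakly_decreasing gamma)
  (mu_decr : weakly_decreasing mu)
  (lambda_ge0 : nonneg_triple lambda)
  (gamma_ge0 : nonneg_triple gamma)
  (mu_ge0 : nonneg_triple mu)
  (total_lambda_gamma : triple_sum lambda = triple_sum gamma)
  (total_gamma_mu : triple_sum gamma = triple_sum mu)
  (lambda_gamma : strictly_dominates lambda gamma)
  (gamma_mu : strictly_dominates gamma mu) :
  (forall x y z : R, 0 < x -> 0 < y -> 0 < z ->
     0 <= P_fun lambda gamma mu x y z) <->
  (forall t : R, 0 < t -> 0 <= Q_fun lambda gamma mu t).
Proof.
split=> [P_ge0 t t0|Q_ge0].
  have := P_ge0 t 1 1 t0 ltr01 ltr01.
  by rewrite P_fun_wall pmulr_rge0.
have [l10 l21] := centred_decr R lambda_decr.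
have [g10 g21] := centred_decr R gamma_decr.
have [m10 m21] := centred_decr R mu_decr.
have [lg0 lg2] := centred_dominates R total_lambda_gamma lambda_gamma.1.
have [gm0 gm2] := centred_dominates R total_gamma_mu gamma_mu.1.
have mean_lg : mean R lambda = mean R gamma by rewrite !meanE total_lambda_gamma.
have mean_gm : mean R mu = mean R gamma by rewrite !meanE total_gamma_mu.
(* Equal sums give equal means, so at [exp t] the three power sums share one positive factor. *)
have Q (t : R) : 2 * psum t (centred R gamma 0) (centred R gamma 1) (centred R gamma 2)
    <= psum t (centred R lambda 0) (centred R lambda 1) (centred R lambda 2)
     + psum t (centred R mu 0) (centred R mu 1) (centred R mu 2).
  have := Q_ge0 _ (expR_gt0 t); rewrite /Q_fun !Q_fun_psum ?expR_gt0 // expRK.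
  rewrite mean_lg mean_gm; set e := expR _ => H.
  have e0 : 0 < e by exact: expR_gt0.
  rewrite -(ler_pM2l e0); lra.
have sorted_case (x y z : R) : 0 < z -> z <= y -> y <= x ->
    0 <= P_fun lambda gamma mu x y z.
  move=> z0 zy yx; have y0 := lt_le_trans z0 zy; have x0 := lt_le_trans y0 yx.
  rewrite /P_fun !orbit_sum_jsum // mean_lg mean_gm; set e := expR _.
  have e0 : 0 <= e by exact: expR_ge0.
  have s0 : 0 <= ln x - ln y by rewrite subr_ge0 ler_ln.
  have r0 : 0 <= ln y - ln z by rewrite subr_ge0 ler_ln.
  have := jsum_ge s0 r0 (centred_sum R lambda) l21 l10 (centred_sum R gamma) g21 g10
    (centred_sum R mu) m21 m10 lg0 lg2 gm0 gm2 Q.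
  move=> /(ler_wpM2l e0); lra.
move=> x y z x0 y0 z0.
have two_case (a b c : R) : 0 < a -> 0 < b -> 0 < c -> b <= a ->
    0 <= P_fun lambda gamma mu a b c.
  move=> a0 b0 c0 ba; case: (leP c b) => [cb|/ltW bc]; first exact: sorted_case.
  rewrite P_fun_swap23; case: (leP c a) => [ca|/ltW ac]; first exact: sorted_case.
  by rewrite P_fun_swap12; exact: sorted_case.
case: (leP y x) => [yx|/ltW xy]; first exact: two_case.
by rewrite P_fun_swap12; exact: two_case.
Qed.
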